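(* Let $n\ge 2$ and let $D$ be a bounded domain in $\mathbb{R}^n$. Then for all $x,y\in D$, $$\zeta_D(x,y)\le i_D^*(x,y)\le m_D(x,y).$$
   Context: A domain is a nonempty open connected set. For a bounded domain $D\subset\mathbb{R}^n$ and $z\in D$, $\delta_D(z)=\inf\{|z-\xi|:\xi\in\partial D\}$, $d(D)$ is the Euclidean diameter of $D$, and $\eta_D(z)=\delta_D(z)\,(d(D)-\delta_D(z))$. For $x,y\in D$ define $$\zeta_D(x,y)=\log\left(1+\frac{d(D)\,|x-y|}{\min\{\eta_D(x),\eta_D(y)\}}\right),$$ $$i_D^*(x,y)=2\log\frac{\eta_D(x)+\eta_D(y)+d(D)\,|x-y|}{2\sqrt{\eta_D(x)\,\eta_D(y)}},$$ $$m_D(x,y)=\inf_{\gamma\in\Gamma_{xy}}\int_\gamma\frac{d(D)}{\eta_D(z)}\,|dz|,$$ where $\Gamma_{xy}$ is the family of all rectifiable paths in $D$ joining $x$ to $y$. *)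

(* Defs.v *)
From HB Require Import structures.
From mathcomp Require Import all_boot all_order all_algebra.
From mathcomp Require Import all_classical all_reals all_analysis.

Set Implicit Arguments.
Unset Strict Implicit.
Unset Printing Implicit Defensive.

Import Order.TTheory GRing.Theory Num.Theory.
Import numFieldNormedType.Exports.

Local Open Scope classical_set_scope.
Local Open Scope ring_scope.

(* The norm of the library on 'rV[R]_n is the maximum norm. It induces the
   usual topology and the usual bounded sets of R^n, so [open], [connected],
   [closure], [continuous] and [bounded_set] are used as they are; all metric
   quantities (distance to the boundary, diameter, length) are computed with
   the Euclidean norm [enorm]. *)
Definition enorm {R : realType} {n : nat} (v : 'rV[R]_n) : R :=
  Num.sqrt (\sum_(i < n) v 0 i ^+ 2).

Definition frontier {T : topologicalType} (A : set T) : set T :=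
  closure A `\` interior A.

Definition is_domain {R : realType} {n : nat} (D : set 'rV[R]_n) : Prop :=
  [/\ D !=set0, open D & connected D].

Definition bdist {R : realType} {n : nat} (D : set 'rV[R]_n) (z : 'rV[R]_n) : R :=
  inf [set enorm (z - xi) | xi in frontier D].

Definition ediam {R : realType} {n : nat} (D : set 'rV[R]_n) : R :=
  sup [set enorm (u.1 - u.2) | u in D `*` D].

Definition etaD {R : realType} {n : nat} (D : set 'rV[R]_n) (z : 'rV[R]_n) : R :=
  bdist D z * (ediam D - bdist D z).

Definition zetaD {R : realType} {n : nat} (D : set 'rV[R]_n) (x y : 'rV[R]_n) : R :=
  ln (1 + ediam D * enorm (x - y) / Num.min (etaD D x) (etaD D y)).

Definition istarD {R : realType} {n : nat} (D : set 'rV[R]_n) (x y : 'rV[R]_n) : R :=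
  2 * ln ((etaD D x + etaD D y + ediam D * enorm (x - y))
          / (2 * Num.sqrt (etaD D x * etaD D y))).

(* Length of the path g restricted to [a, b]: the supremum of the lengths of
   the inscribed polygonal lines. A list s with [itv_partition a b s] stands
   for the subdivision a :: s of [a, b]. *)
Definition polyline_length {R : realType} {n : nat} (a b : R)
    (g : R -> 'rV[R]_n) (s : seq R) : R :=
  let G := g \o nth b (a :: s) in
  \sum_(0 <= k < size s) enorm (G k.+1 - G k).

Definition path_length {R : realType} {n : nat} (a b : R)
    (g : R -> 'rV[R]_n) : \bar R :=
  ereal_sup [set (polyline_length a b g s)%:E | s in itv_partition a b].

(* The families of paths and the line integrals below concern a path
   g : [a, b] -> R^n, represented by a total function whose values outside
   [a, b] are never used. *)
Definition rectifiable_path {R : realType} {n : nat} (D : set 'rV[R]_n)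
    (x y : 'rV[R]_n) (a b : R) (g : R -> 'rV[R]_n) : Prop :=
  [/\ a <= b, {within `[a, b], continuous g},
      (forall t, t \in `[a, b] -> D (g t)),
      g a = x /\ g b = y & (path_length a b g < +oo)%E].

(* Parametrization by arc length: the point g t, for any t in [a, b] such that
   g restricted to [a, t] has length s (g is constant on the set of these t). *)
Definition arc_param {R : realType} {n : nat} (a b : R)
    (g : R -> 'rV[R]_n) (s : R) : 'rV[R]_n :=
  g (xget a [set t | t \in `[a, b] /\ path_length a t g = s%:E]).

(* Integral of rho over a rectifiable path with respect to arc length |dz|. *)
Definition line_integral {R : realType} {n : nat} (rho : 'rV[R]_n -> R)
    (a b : R) (g : R -> 'rV[R]_n) : \bar R :=
  (\int[lebesgue_measure]_(s in `[0%R, fine (path_length a b g)])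
     (rho (arc_param a b g s))%:E)%E.

(* The values are in the extended reals because line integrals are. *)
Definition mD {R : realType} {n : nat} (D : set 'rV[R]_n)
    (x y : 'rV[R]_n) : \bar R :=
  ereal_inf [set I | exists a b (g : R -> 'rV[R]_n),
    rectifiable_path D x y a b g /\
    I = line_integral (fun z => ediam D / etaD D z) a b g].

(* Main.v *)
Require Import Defs.
From mathcomp Require Import all_boot all_order all_algebra.
From mathcomp Require Import all_classical all_reals all_analysis.
From mathcomp Require Import measurable_realfun.
From mathcomp Require Import ring lra.
Import Order.TTheory GRing.Theory Num.Theory.
Import numFieldNormedType.Exports.
Local Open Scope classical_set_scope.
Local Open Scope ring_scope.
Set Implicit Arguments.
Unset Strict Implicit.
Unset Printing Implicit Defensive.

(** Write d for the diameter of D, a and b for the values of eta at x and y,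
    and M = (a + b + d|x - y|) / 2, so that i* is log (M / a) + log (M / b).

    The inequality zeta <= i* only concerns the three numbers a, b and
    t = d|x - y|: if a <= b it reads 4 b (a + t) <= (b + (a + t))^2, the
    arithmetic-geometric inequality for b and a + t
    ([ln_gap_le_two_ln_mean]).

    The inequality i* <= m rests on eta being positive and d-Lipschitz on D.
    Since a ball about z of radius delta(z) lies in D, delta <= d / 2
    ([bdist_le_half_ediam]); as delta is 1-Lipschitz and
    r |-> r (d - r) has slope in [0, d] on [0, d / 2], eta = delta (d - delta)
    is d-Lipschitz ([etaD_lip]). Along a path of length L parametrized by arc
    length, u(s) = eta(gamma(s)) therefore goes from a to b and satisfies
    u(s) <= min (a + d s, b + d (L - s)). The two bounds agree where their
    common value is (a + b + d L) / 2, and dividing d by the smaller one and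
    integrating on either side of this point gives exactly
    log ((a + b + d L) / (2 a)) + log ((a + b + d L) / (2 b)). This is a lower
    bound for the integral of d / u ([integral_lipschitz_inv_ge]), and is at
    least i* because L >= |x - y|.

    It remains that the arc-length parametrization is well defined and
    1-Lipschitz ([arc_paramP], [arc_param_lip]). Well-definedness is the
    intermediate value theorem for the length function t |-> V(t), whose
    continuity is the delicate point: V grows at most as fast as the sum T of
    the total variations of the coordinates
    ([length_increment_le_variation]), and each of these is continuous along
    with its coordinate. *)

(** * The Euclidean norm *)

Section EuclideanNorm.
Context {R : realType} {n : nat}.
Implicit Types u v : 'rV[R]_n.

Lemma sum_sqr_ge0 (I : finType) (f : I -> R) : 0 <= \sum_i f i ^+ 2.
Proof. by apply: sumr_ge0 => i _; exact: sqr_ge0. Qed.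

Lemma enorm_ge0 v : 0 <= enorm v.
Proof. exact: sqrtr_ge0. Qed.

Lemma enorm0 : enorm (0 : 'rV[R]_n) = 0.
Proof.
by rewrite /enorm big1 ?sqrtr0// => i _; rewrite mxE expr0n.
Qed.

Lemma enormZ (c : R) v : enorm (c *: v) = `|c| * enorm v.
Proof.
rewrite /enorm -sqrtr_sqr -sqrtrM ?sqr_ge0// mulr_sumr.
by congr Num.sqrt; apply: eq_bigr => i _; rewrite mxE exprMn.
Qed.

Lemma enormN v : enorm (- v) = enorm v.
Proof. by rewrite -scaleN1r enormZ normrN1 mul1r. Qed.

Lemma enormB u v : enorm (u - v) = enorm (v - u).
Proof. by rewrite -enormN opprB. Qed.

(** Cauchy-Schwarz, from Lagrange's identity: the sum of the squares
    (u_i v_j - u_j v_i)^2 is twice the difference of the squared sides. *)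
Lemma sum_mul_le_enorm u v : \sum_i u 0 i * v 0 i <= enorm u * enorm v.
Proof.
rewrite /enorm -sqrtrM ?sum_sqr_ge0//.
apply: (le_trans (ler_norm _)); rewrite -sqrtr_sqr ler_sqrt; last first.
  by apply: mulr_ge0; exact: sum_sqr_ge0.
have : 0 <= \sum_i \sum_j (u 0 i * v 0 j - u 0 j * v 0 i) ^+ 2.
  by apply: sumr_ge0 => i _; exact: sum_sqr_ge0.
have -> : \sum_i \sum_j (u 0 i * v 0 j - u 0 j * v 0 i) ^+ 2 =
    (\sum_i u 0 i ^+ 2) * (\sum_i v 0 i ^+ 2)
    + (\sum_i u 0 i ^+ 2) * (\sum_i v 0 i ^+ 2)
    - 2 * (\sum_i u 0 i * v 0 i) ^+ 2.
  rewrite expr2 {1}mulr_suml [X in _ + X - _]mulrC !mulr_suml mulr_sumr.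
  rewrite -big_split -sumrB/=; apply: eq_bigr => i _.
  rewrite !mulr_sumr -big_split -sumrB/=; apply: eq_bigr => j _; ring.
lra.
Qed.

Lemma ler_enormD u v : enorm (u + v) <= enorm u + enorm v.
Proof.
rewrite -(@ler_pXn2r _ 2)// ?nnegrE ?addr_ge0 ?enorm_ge0//.
have sq (w : 'rV[R]_n) : enorm w ^+ 2 = \sum_i w 0 i ^+ 2.
  by rewrite sqr_sqrtr// sum_sqr_ge0.
rewrite sqrrD !sq.
have -> : \sum_i (u + v) 0 i ^+ 2 = \sum_i u 0 i ^+ 2
    + (\sum_i u 0 i * v 0 i) *+ 2 + \sum_i v 0 i ^+ 2.
  rewrite -mulr_natl mulr_sumr -!big_split/=; apply: eq_bigr => i _.
  by rewrite mxE; ring.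
by rewrite lerD2r lerD2l lerMn2r/= sum_mul_le_enorm.
Qed.

Lemma ler_enorm_dist w u v : enorm (u - v) <= enorm (u - w) + enorm (w - v).
Proof. by rewrite (le_trans _ (ler_enormD _ _))// addrA subrK. Qed.

Lemma coord_le_enorm v i : `|v 0 i| <= enorm v.
Proof.
rewrite -sqrtr_sqr ler_sqrt ?sum_sqr_ge0// (bigD1 i)//= lerDl.
by apply: sumr_ge0 => j _; exact: sqr_ge0.
Qed.

(** With [enorm_le_sum], this compares the Euclidean norm with the maximum norm,
    which defines the topology and the bounded sets. *)
Lemma norm_le_enorm v : `|v| <= enorm v.
Proof.
rewrite /Num.norm/= mx_normrE; apply: bigmax_le => [|[i j] _ /=].
  exact: enorm_ge0.
by rewrite ord1 coord_le_enorm.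
Qed.

Lemma enorm_le_sum v : enorm v <= \sum_i `|v 0 i|.
Proof.
have s0 : 0 <= \sum_i `|v 0 i| by apply: sumr_ge0.
rewrite -[leRHS](ger0_norm s0) -sqrtr_sqr ler_sqrt ?sqr_ge0// expr2 mulr_suml.
apply: ler_sum => i _; rewrite -normr_id -[leLHS]ger0_norm ?sqr_ge0//.
rewrite normr_id normrX expr2 ler_wpM2l// (bigD1 i)//= lerDl.
by apply: sumr_ge0.
Qed.

Lemma enorm_eq0 v : enorm v = 0 -> v = 0.
Proof.
by move=> v0; apply/eqP; rewrite -normr_le0 -v0 norm_le_enorm.
Qed.

End EuclideanNorm.

(** * Distance to the boundary *)

Section Geometry.
Context {R : realType} {n : nat}.
Variable D : set 'rV[R]_n.
Implicit Types z w : 'rV[R]_n.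

(** A segment without frontier points meets D in a set that is both open and
    closed in the segment, and so cannot leave D. *)
Lemma frontier_on_segment z w : open D -> D z -> ~ D w ->
  exists2 xi, frontier D xi & enorm (z - xi) <= enorm (z - w).
Proof.
move=> oD Dz nDw.
pose p (t : R) := z + t *: (w - z).
have cp : continuous p.
  move=> t; apply: cvgD; first exact: cvg_cst.
  by apply: cvgZr_tmp; exact: cvg_id.
have [[t [/= t01 ft]]|nf] := pselect (exists t, t \in `[0, 1] /\ frontier D (p t)).
  exists (p t) => //; move: t01; rewrite in_itv/= => /andP[t0 t1].
  rewrite /p opprD addrA subrr add0r enormN enormZ ger0_norm//.
  by rewrite (enormB w) ler_piMl// enorm_ge0.
exfalso; apply: nDw.
have c01 : connected (`[0, 1]%classic : set R).
  by apply/connected_intervalP; exact: interval_is_interval.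
have/seteqP[_ /(_ 1)] : `[0, 1]%classic `&` p @^-1` D = (`[0, 1]%classic : set R).
  apply: c01.
  - by exists 0; split; rewrite /= ?in_itv/= ?lexx ?ler01// /p scale0r addr0.
  - by exists (p @^-1` D) => //; apply: open_comp.
  - exists (p @^-1` closure D); first by apply: preimage_closed => //; exact: closed_closure.
    apply/seteqP; split => t [t01 /= Dt]; split => //; first exact: subset_closure.
    apply: contrapT => nDt; apply: nf; exists t; split => //.
    by split => // /interior_subset.
rewrite /= in_itv/= lexx ler01 => /(_ isT)[_].
by rewrite /p scale1r addrC subrK.
Qed.

Hypothesis n_gt0 : (0 < n)%N.
Hypothesis oD : open D.
Hypothesis bD : bounded_set D.

Let e : 'rV[R]_n := delta_mx 0 (Ordinal n_gt0).

Lemma enorm_axis : enorm e = 1.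
Proof.
rewrite /enorm (bigD1 (Ordinal n_gt0))//= big1 ?addr0.
  by rewrite mxE !eqxx expr1n sqrtr1.
by move=> i ni; rewrite mxE (negbTE ni) andbF expr0n.
Qed.

Lemma enorm_bounded : exists M, forall z, D z -> enorm z <= M.
Proof.
have [M [_ HM]] := bD.
exists (\sum_(i < n) (M + 1)) => z /(HM (M + 1)) zM.
apply: le_trans (enorm_le_sum _) _; apply: ler_sum => i _.
apply: le_trans (zM _); last by rewrite ltrDl.
by rewrite [leRHS]mx_normrE; apply: (le_bigmax _ _ (0, i)).
Qed.

Lemma exists_notin z : exists w, ~ D w.
Proof.
have [M HM] := enorm_bounded.
exists ((`|M| + 1) *: e) => /HM; rewrite enormZ enorm_axis mulr1.
rewrite ger0_norm ?addr_ge0// => H; have := ler_norm M; lra.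
Qed.

Lemma frontier_neq0 z : D z -> frontier D !=set0.
Proof.
move=> Dz; have [w nDw] := exists_notin z.
by have [xi ? _] := frontier_on_segment oD Dz nDw; exists xi.
Qed.

Lemma bdist_le z xi : frontier D xi -> bdist D z <= enorm (z - xi).
Proof.
move=> fxi; apply: ge_inf; last by exists xi.
by exists 0 => _ [w _ <-]; exact: enorm_ge0.
Qed.

(** The point x0 of D makes the frontier nonempty; without it the infimum
    defining [bdist] would be that of the empty set. *)
Lemma le_bdist x0 z r : D x0 ->
  (forall xi, frontier D xi -> r <= enorm (z - xi)) -> r <= bdist D z.
Proof.
move=> Dx0 H; apply: lb_le_inf; last by move=> _ [xi /H ? <-].
by have [xi ?] := frontier_neq0 Dx0; exists (enorm (z - xi)); exists xi.
Qed.

Lemma bdist_lip z w : D z -> bdist D z <= bdist D w + enorm (z - w).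
Proof.
move=> Dz; rewrite -lerBlDr; apply: (le_bdist Dz) => xi fxi.
rewrite lerBlDr (le_trans (bdist_le _ fxi))// [leRHS]addrC.
exact: ler_enorm_dist.
Qed.

Lemma bdist_gt0 z : D z -> 0 < bdist D z.
Proof.
move=> Dz; have /nbhs_ballP[r /= r0 rD] : nbhs z D by apply: open_nbhs_nbhs.
apply: (lt_le_trans r0); apply: (le_bdist Dz) => xi [_ nxi].
rewrite leNgt; apply/negP => zxi; apply: nxi.
have -> : interior D = D by apply/interior_id.
by apply: rD; rewrite -ball_normE/= (le_lt_trans (norm_le_enorm _)).
Qed.

Lemma bdist_ball z w : D z -> enorm (z - w) < bdist D z -> D w.
Proof.
move=> Dz zw; apply: contrapT => nDw.
have [xi /(bdist_le z) ? ?] := frontier_on_segment oD Dz nDw.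
by have : enorm (z - w) < enorm (z - w); rewrite ?ltxx//; lra.
Qed.

Lemma le_ediam z w : D z -> D w -> enorm (z - w) <= ediam D.
Proof.
move=> Dz Dw; apply: ub_le_sup; last by exists (z, w).
have [M HM] := enorm_bounded; exists (M + M) => _ [[u v] [/= Du Dv] <-].
by rewrite (le_trans (ler_enormD _ _))// enormN lerD// HM.
Qed.

(** For every t < delta(z) both z + t e and z - t e, with e a unit vector, are
    points of D at distance 2 t. *)
Lemma bdist_le_half_ediam z : D z -> bdist D z *+ 2 <= ediam D.
Proof.
move=> Dz; apply/ler_addgt0Pr => eps eps0.
pose t := bdist D z - eps / 2.
have Dt (c : R) : `|c| < bdist D z -> D (z + c *: e).
  move=> cz; apply: (bdist_ball Dz).
  by rewrite opprD addrA subrr add0r enormN enormZ enorm_axis mulr1.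
have [t0|t0] := leP 0 t; last first.
  have := le_ediam Dz Dz; rewrite subrr enorm0 => d0.
  by rewrite mulr2n; rewrite /t in t0; lra.
have tz : `|t| < bdist D z by rewrite ger0_norm// /t; lra.
have := le_ediam (Dt t tz) (Dt (- t) _); rewrite normrN => /(_ tz).
rewrite opprD addrACA subrr add0r -scaleNr opprK -scalerDl enormZ enorm_axis mulr1.
rewrite (ger0_norm (addr_ge0 t0 t0)) /t => d2t.
by rewrite mulr2n; lra.
Qed.

Lemma etaD_gt0 z : D z -> 0 < etaD D z.
Proof.
move=> Dz; rewrite /etaD.
have := bdist_gt0 Dz; have := bdist_le_half_ediam Dz; rewrite mulr2n => h p.
rewrite mulr_gt0//; lra.
Qed.

Lemma ediam_gt0 z : D z -> 0 < ediam D.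
Proof.
move=> Dz; have := bdist_gt0 Dz; have := bdist_le_half_ediam Dz.
by rewrite mulr2n; lra.
Qed.

(** With r, r' the distances of z, w to the boundary,
    eta(z) - eta(w) = (r - r') (d - r - r') and 0 <= d - r - r' <= d. *)
Lemma etaD_lip z w : D z -> D w ->
  etaD D z <= etaD D w + ediam D * enorm (z - w).
Proof.
move=> Dz Dw; rewrite /etaD.
have := bdist_gt0 Dz; have := bdist_le_half_ediam Dz.
have := bdist_gt0 Dw; have := bdist_le_half_ediam Dw.
have := bdist_lip w Dz; rewrite !mulr2n => h h1 h2 h3 h4.
have := enorm_ge0 (z - w) => h5; nra.
Qed.

End Geometry.

(** * Length of a path *)

(** Continuity passes from a function to any function with smaller increments:
    from the variations of the coordinates to the length, and from s |-> d s to
    a d-Lipschitz function. *)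
Lemma within_continuous_dominated {R : realType} (a b : R) (f h : R -> R) :
  {in `[a, b] &, forall u v, `|f u - f v| <= `|h u - h v|} ->
  {within `[a, b], continuous h} -> {within `[a, b], continuous f}.
Proof.
move=> fh /subspace_continuousP ch; apply/subspace_continuousP => x xab.
apply/cvgrPdist_le => eps eps0.
have /cvgrPdist_le/(_ _ eps0) := ch x xab.
rewrite !near_withinE; apply: filterS => y + yab => /(_ yab).
exact: le_trans (fh _ _ xab yab).
Qed.

Section ArcLength.
Context {R : realType} {n : nat}.
Implicit Types (a b u v : R) (g : R -> 'rV[R]_n).

Lemma polyline_length_le_path_length a b g s : itv_partition a b s ->
  ((polyline_length a b g s)%:E <= path_length a b g)%E.
Proof. by move=> abs; apply: ereal_sup_ubound; exists s. Qed.

Lemma path_lengthxx a g : path_length a a g = 0%E.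
Proof.
have pxx : polyline_length a a g [::] = 0 by rewrite /polyline_length big_geq.
apply/eqP; rewrite eq_le; apply/andP; split.
  by apply: ge_ereal_sup => _ [s /itv_partitionxx -> <-]; rewrite pxx.
rewrite -[leLHS]/(0%:E) -pxx.
by apply: polyline_length_le_path_length; split => /=.
Qed.

Lemma polyline_length_rcons a u v g s : itv_partition a u s ->
  polyline_length a v g (rcons s v) = polyline_length a u g s + enorm (g v - g u).
Proof.
move=> aus; rewrite /polyline_length size_rcons big_nat_recr//=.
have nthE k : (k <= size s)%N -> nth v (a :: rcons s v) k = nth u (a :: s) k.
  by rewrite -rcons_cons nth_rcons/= ltnS => ks; rewrite ks; apply: set_nth_default.
congr (_ + enorm (g _ - g _)).
- apply: eq_big_nat => k /andP[_ ks].
  by rewrite -[nth v (rcons s v) k]/(nth v (a :: rcons s v) k.+1) !nthE// ltnW.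
- by rewrite nth_rcons ltnn eqxx.
- by rewrite nthE// (itv_partition_nth_size u aus).
Qed.

(** Appending v to a subdivision of [a, u] gives a subdivision of [a, v]. *)
Lemma path_length_superadditive a u v g : a <= u -> u <= v ->
  (path_length a u g + (enorm (g v - g u))%:E <= path_length a v g)%E.
Proof.
move=> au; rewrite le_eqVlt => /predU1P[<-|uv]; first by rewrite subrr enorm0 adde0.
rewrite -leeBrDr//; apply: ge_ereal_sup => _ [s aus <-].
rewrite leeBrDr// -EFinD -polyline_length_rcons//.
apply: polyline_length_le_path_length; case: aus => pas /eqP las; split.
  by rewrite rcons_path pas las.
by rewrite last_rcons.
Qed.

Lemma path_length_ge0 a b g : a <= b -> (0 <= path_length a b g)%E.
Proof.
move=> ab; apply: le_trans (path_length_superadditive g (lexx a) ab).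
by rewrite path_lengthxx add0e lee_fin enorm_ge0.
Qed.

(** Chords dominated by increments of one function telescope along every
    subdivision, which bounds the length without splitting subdivisions. *)
Lemma path_length_le_increment a b g (H : R -> R) :
  (forall p q, a <= p -> p <= q -> q <= b -> enorm (g q - g p) <= H q - H p) ->
  (path_length a b g <= (H b - H a)%:E)%E.
Proof.
move=> gH; apply: ge_ereal_sup => _ [s abs <-]; rewrite lee_fin.
apply: (@le_trans _ _ (\sum_(0 <= k < size s)
    (H (nth b (a :: s) k.+1) - H (nth b (a :: s) k)))).
  apply: ler_sum_nat => k /andP[_ ks]; apply: gH.
  - by apply: itv_partition_nth_ge => //; rewrite ltnS ltnW.
  - by case: abs => /(pathP b)/(_ k ks)/ltW.
  - exact: itv_partition_nth_le.
by rewrite telescope_sumr// (itv_partition_nth_size b abs).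
Qed.

End ArcLength.

(** * Parametrization by arc length *)

Section ArcLengthParametrization.
Context {R : realType} {n : nat}.
Variables (a b : R) (g : R -> 'rV[R]_n).
Hypothesis ab : a <= b.
Hypothesis cg : {within `[a, b], continuous g}.
Hypothesis rg : (path_length a b g < +oo)%E.

Local Notation V t := (fine (path_length a t g)).
Local Notation T t :=
  (\sum_i fine (total_variation a t (fun r => g r 0 i))).

Lemma path_length_EFin t : a <= t -> t <= b -> path_length a t g = (V t)%:E.
Proof.
move=> at_ tb; rewrite fineK// ge0_fin_numE; last exact: path_length_ge0.
apply: le_lt_trans rg; apply: le_trans (path_length_superadditive g at_ tb).
by rewrite leeDl// lee_fin enorm_ge0.
Qed.

Lemma chord_le_length_increment u v : a <= u -> u <= v -> v <= b ->
  enorm (g v - g u) <= V v - V u.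
Proof.
move=> au uv vb; have := path_length_superadditive g au uv.
rewrite (path_length_EFin au (le_trans uv vb)).
rewrite (path_length_EFin (le_trans au uv) vb).
by rewrite -EFinD lee_fin; lra.
Qed.

Lemma coord_bounded_variation i : bounded_variation a b (fun r => g r 0 i).
Proof.
exists (V b) => _ [s abs <-]; rewrite -lee_fin -path_length_EFin//.
apply: le_trans (polyline_length_le_path_length g abs); rewrite lee_fin.
by apply: ler_sum => k _ /=; apply: le_trans (coord_le_enorm _ i); rewrite !mxE.
Qed.

Lemma chord_le_variation_increment u v : a <= u -> u <= v -> v <= b ->
  enorm (g v - g u) <= T v - T u.
Proof.
move=> au uv vb; apply: le_trans (enorm_le_sum _) _; rewrite -sumrB.
apply: ler_sum => i _; rewrite !mxE.
have av := le_trans au uv.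
have fin w : a <= w -> w <= b ->
    total_variation a w (fun r => g r 0 i) \is a fin_num.
  move=> aw wb; apply/bounded_variationP => //.
  exact: bounded_variationl (coord_bounded_variation i).
rewrite lerBrDl -lee_fin EFinD !fineK ?fin//; last exact: le_trans uv vb.
rewrite (total_variationD _ au uv) leeD2l//.
exact: (total_variation_ge (fun r => g r 0 i) uv).
Qed.

(** The arc from u to v is at most as long as the sum of the variations of the
    coordinates on [u, v]. Instead of cutting subdivisions at u, one dominates
    the chords by the increments of a single function that follows V before u
    and T after u. *)
Lemma length_increment_le_variation u v : a <= u -> u <= v -> v <= b ->
  V v - V u <= T v - T u.
Proof.
move=> au uv vb.
pose H t := V (Num.min t u) + T (Num.max t u).
have av := le_trans au uv; have ub := le_trans uv vb.
have : (path_length a v g <= (H v - H a)%:E)%E.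
  apply: path_length_le_increment => p q ap pq qv; rewrite /H.
  have qb := le_trans qv vb.
  (* chord before u, across u (triangle inequality through g u), after u *)
  have [qu|uq] := leP q u.
    rewrite (min_idPl (le_trans pq qu)) (max_idPr (le_trans pq qu)).
    by have := chord_le_length_increment ap pq qb; lra.
  have [pu|up] := leP p u.
    have := chord_le_length_increment ap pu ub.
    have := chord_le_variation_increment au (ltW uq) qb.
    by have := ler_enorm_dist (g u) (g q) (g p); lra.
  by have := chord_le_variation_increment ap pq qb; lra.
rewrite path_length_EFin// lee_fin /H (min_idPr uv) (max_idPl uv).
rewrite (min_idPl au) (max_idPr au) path_lengthxx/=; lra.
Qed.

Lemma length_continuous : a < b -> {within `[a, b], continuous (fun t => V t)}.
Proof.
move=> ltab; apply: (@within_continuous_dominated _ _ _ _ (fun t => T t)).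
  move=> u v; rewrite !in_itv/= => /andP[au ub] /andP[av vb].
  wlog uv : u v au ub av vb / u <= v.
    move=> wl; have [uv|/ltW vu] := leP u v; first exact: wl.
    by rewrite distrC [leRHS]distrC; exact: wl.
  rewrite distrC [leRHS]distrC.
  have VT := length_increment_le_variation au uv vb.
  rewrite (le_trans _ (ler_norm _))// ger0_norm//.
  exact: le_trans (enorm_ge0 _) (chord_le_length_increment au uv vb).
have cT i : {within `[a, b], continuous
    (fine \o (fun t => total_variation a t (fun r => g r 0 i)))}.
  apply: total_variation_continuous => //; last exact: coord_bounded_variation.
  move=> x.
  exact: (cvg_comp g (fun w : 'rV[R]_n => w 0 i) (@cg x)
    (@coord_continuous R 1 n 0 i (g x))).
apply: continuous_big => [|i _]; first exact: add_continuous.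
exact: cT.
Qed.

(** Continuity of V is what makes every s in [0, V b] the length of an initial
    arc, so that [arc_param] never takes its default value. *)
Lemma exists_length_eq s : s \in `[0, V b] ->
  exists t, t \in `[a, b] /\ path_length a t g = s%:E.
Proof.
rewrite in_itv/= => /andP[s0 sV].
move: ab; rewrite le_eqVlt => /predU1P[eab|ltab].
  exists a; rewrite in_itv/= lexx ab path_lengthxx; split => //.
  have V0 : V b = 0 by rewrite -eab path_lengthxx.
  by congr EFin; apply/eqP; rewrite eq_le s0 -V0 sV.
have Va : V a = 0 by rewrite path_lengthxx.
have [|t tab Vt] := @IVT _ (fun t => V t) a b s ab (length_continuous ltab).
  by rewrite Va (min_idPl (le_trans s0 sV)) (max_idPr (le_trans s0 sV)) s0.
exists t; split => //; move: tab; rewrite in_itv/= => /andP[at_ tb].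
by rewrite path_length_EFin// Vt.
Qed.

Lemma arc_paramP s : s \in `[0, V b] ->
  exists t, [/\ a <= t, t <= b, V t = s & arc_param a b g s = g t].
Proof.
move=> /exists_length_eq sV; rewrite /arc_param.
set E := [set t | _].
have [] : E (xget a E) by case: sV => t Et; apply: xgetI Et.
rewrite in_itv/= => /andP[at_ tb] Vt; exists (xget a E); split => //.
by rewrite Vt.
Qed.

Lemma arc_param_lip s s' : s \in `[0, V b] -> s' \in `[0, V b] ->
  enorm (arc_param a b g s - arc_param a b g s') <= `|s - s'|.
Proof.
move=> /arc_paramP[t [at_ tb <- ->]] /arc_paramP[t' [at' tb' <- ->]].
wlog tt' : t t' at_ tb at' tb' / t' <= t.
  move=> wl; have [|/ltW] := leP t' t; first exact: wl.
  by rewrite enormB distrC; exact: wl.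
by apply: le_trans (ler_norm _); exact: chord_le_length_increment.
Qed.

(** The parameter selected by [arc_param] for s = 0 need not be a, but the path
    is constant up to it; likewise for b in [arc_param_end]. *)
Lemma arc_param_start : arc_param a b g 0 = g a.
Proof.
have V0 : 0 <= V b by rewrite -lee_fin -path_length_EFin// path_length_ge0.
have /arc_paramP[t [at_ tb Vt ->]] : 0 \in `[0, V b] by rewrite in_itv/= lexx V0.
apply/eqP; rewrite -subr_eq0; apply/eqP/enorm_eq0/le_anti.
rewrite enorm_ge0 andbT (le_trans (chord_le_length_increment (lexx a) at_ tb))//.
by rewrite Vt path_lengthxx subrr.
Qed.

Lemma arc_param_end : arc_param a b g (V b) = g b.
Proof.
have V0 : 0 <= V b by rewrite -lee_fin -path_length_EFin// path_length_ge0.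
have /arc_paramP[t [at_ tb Vt ->]] : V b \in `[0, V b] by rewrite in_itv/= lexx V0.
apply/esym/eqP; rewrite -subr_eq0; apply/eqP/enorm_eq0/le_anti.
rewrite enorm_ge0 andbT (le_trans (chord_le_length_increment at_ tb (lexx b)))//.
by rewrite Vt subrr.
Qed.

End ArcLengthParametrization.

(** * The integral of the reciprocal of a Lipschitz function *)

Section ReciprocalIntegral.
Context {R : realType}.
Local Notation mu := (@lebesgue_measure R).

(** The sign sg = -1 serves decreasing affine functions, for which the integrand
    d / (al + be s) with d > 0 has be = - d. *)
Lemma integral_affine_inv (sg al be p q : R) : p <= q ->
  {in `[p, q], forall s, 0 < al + be * s} ->
  (\int[mu]_(s in `[p, q]) (sg * (be / (al + be * s)))%:E =
   (sg * (ln (al + be * q) - ln (al + be * p)))%:E)%E.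
Proof.
rewrite le_eqVlt => /predU1P[<- _|pq pos].
  by rewrite set_itv1 integral_set1 subrr mulr0.
have cvg_affine (s : R) : al + be * t @[t --> s] --> al + be * s.
  by apply: cvgD; [exact: cvg_cst|apply: cvgMl_tmp; exact: cvg_id].
pose F s := sg * ln (al + be * s).
have cF s : s \in `[p, q] -> {for s, continuous F}.
  move=> /pos pos_s; apply: cvgMl_tmp.
  exact: (cvg_comp (fun t => al + be * t) (@ln R) (cvg_affine s) (continuous_ln pos_s)).
have dF s : s \in `[p, q] -> is_derive s 1 F (sg * (be / (al + be * s))).
  move=> /pos pos_s.
  have dln := is_derive1_ln pos_s.
  have daff : is_derive s 1 (fun t : R => al + be * t) be.
    by apply: is_derive_eq; rewrite add0r mul1r /GRing.scale/= mulr1.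
  have dcomp := @is_derive1_comp _ (@ln R) (fun t => al + be * t) s _ _ dln daff.
  have := @is_deriveZ _ _ _ _ sg _ _ _ dcomp.
  by rewrite /GRing.scale/= (mulrC _ be).
have itvW s : s \in `]p, q[ -> s \in `[p, q] by exact: subset_itv_oo_cc.
rewrite (@continuous_FTC2 _ _ F)//.
- by rewrite -EFinB /F mulrBr.
- apply: continuous_in_subspaceT => s; rewrite inE/= => /pos pos_s.
  apply: cvgMl_tmp; apply: cvgMl_tmp; apply: cvgV; first by rewrite gt_eqF.
  exact: cvg_affine.
- split.
  + by move=> s /itvW/dF [].
  + by apply: cvg_at_right_filter; apply: cF; rewrite in_itv/= lexx ltW.
  + by apply: cvg_at_left_filter; apply: cF; rewrite in_itv/= lexx ltW.
- by move=> s /itvW/dF ds; rewrite derive1E derive_val.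
Qed.

(** The form in which i* appears as a sum of two logarithmic increments, one for
    each end of the path. *)
Lemma two_ln_over_sqrt (M a b : R) : 0 < M -> 0 < a -> 0 < b ->
  2 * ln (M / (2 * Num.sqrt (a * b))) =
  (ln (M / 2) - ln a) + (ln (M / 2) - ln b).
Proof.
move=> M0 a0 b0.
have ab0 : 0 < a * b by exact: mulr_gt0.
have s0 : 0 < Num.sqrt (a * b) by rewrite sqrtr_gt0.
rewrite mulr_natl -lnXn ?divr_gt0 ?mulr_gt0// -!ln_div ?posrE ?divr_gt0//.
rewrite -lnM ?posrE ?divr_gt0//; congr ln.
rewrite expr_div_n exprMn sqr_sqrtr ?(ltW ab0)//.
by field; rewrite !gt_eqF.
Qed.

(** The Lipschitz condition bounds u by the two affine functions of slope d and
    - d through its end values. The left-hand side is the integral of d over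
    their minimum, computed on the two sides of the point c where they meet. *)
Lemma integral_lipschitz_inv_ge (d L : R) (u : R -> R) : 0 < d -> 0 <= L ->
  {in `[0, L], forall s, 0 < u s} ->
  {in `[0, L] &, forall s t, `|u s - u t| <= d * `|s - t|} ->
  ((2 * ln ((u 0 + u L + d * L) / (2 * Num.sqrt (u 0 * u L))))%:E <=
   \int[mu]_(s in `[0%R, L]) (d / u s)%:E)%E.
Proof.
move=> d0 L0 upos ulip.
have in0 : 0 \in `[0, L] by rewrite in_itv/= lexx.
have inL : L \in `[0, L] by rewrite in_itv/= lexx L0.
have a0 := upos _ in0; have b0 := upos _ inL.
have := ulip _ _ inL in0; rewrite subr0 (ger0_norm L0) ler_norml => /andP[lip1 lip2].
set a := u 0 in a0 lip1 lip2 *; set b := u L in b0 lip1 lip2 *.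
set M := a + b + d * L.
have M0 : 0 < M by rewrite /M ltr_wpDr ?mulr_ge0 ?addr_gt0// ltW.
(* the solution of a + d c = b + d (L - c) = M / 2; it lies in [0, L] because
   |b - a| <= d L *)
pose c := (M / 2 - a) / d.
have dc : d * c = M / 2 - a by rewrite /c mulrC divfK// gt_eqF.
have c0 : 0 <= c by rewrite divr_ge0 ?(ltW d0)// /M; lra.
have cL : c <= L by rewrite /c ler_pdivrMr// /M; lra.
have cu : {within `[0, L], continuous u}.
  apply: (@within_continuous_dominated _ _ _ _ (fun s => d * s)).
    by move=> s t si ti; rewrite -mulrBr normrM (gtr0_norm d0) ulip.
  by apply: continuous_subspaceT => s; apply: cvgMl_tmp; exact: cvg_id.
have mf : measurable_fun `[0, L] (EFin \o (fun s => d / u s)).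
  apply/measurable_EFinP; apply: subspace_continuous_measurable_fun => //.
  apply/subspace_continuousP => s si; apply: cvgMl_tmp; apply: cvgV.
    by rewrite gt_eqF// upos.
  by move/subspace_continuousP : cu => /(_ s si).
have f0 s : `[0, L]%classic s -> (0 <= (d / u s)%:E)%E.
  by move=> si; rewrite lee_fin divr_ge0 ?(ltW d0)// ltW// upos.
have piece p q sg al be : 0 <= p -> p <= q -> q <= L -> sg * be = d ->
    {in `[p, q], forall s, u s <= al + be * s} ->
    ((sg * (ln (al + be * q) - ln (al + be * p)))%:E <=
      \int[mu]_(s in `[p, q]) (d / u s)%:E)%E.
  move=> p0 pq qL sgbe ule.
  have sub s : s \in `[p, q] -> s \in `[0, L].
    rewrite !in_itv/= => /andP[ps sq].
    by rewrite (le_trans p0 ps) (le_trans sq qL).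
  have pos : {in `[p, q], forall s, 0 < al + be * s}.
    by move=> s si; apply: lt_le_trans (ule s si); apply/upos/sub.
  rewrite -integral_affine_inv//; apply: ge0_le_integral => //.
  - move=> s si; rewrite lee_fin mulrA sgbe divr_ge0 ?(ltW d0)// ltW//.
    exact: pos.
  - apply/measurable_EFinP; apply: subspace_continuous_measurable_fun => //.
    apply: continuous_in_subspaceT => s; rewrite inE/= => /pos pos_s.
    apply: cvgMl_tmp; apply: cvgMl_tmp; apply: cvgV; first by rewrite gt_eqF.
    by apply: cvgD; [exact: cvg_cst|apply: cvgMl_tmp; exact: cvg_id].
  - by apply: measurable_funS mf => // s; exact: sub.
  - move=> s si; rewrite lee_fin mulrA sgbe ler_pM2l//.
    by rewrite lef_pV2 ?posrE ?ule ?pos// upos// sub.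
have splitE : `[0, c]%classic `|` `]c, L]%classic = `[0, L]%classic.
  by rewrite -itv_bndbnd_setU// bnd_simp.
rewrite -[in leRHS]splitE ge0_integral_setU//; last 3 first.
- by rewrite splitE.
- by move=> s sU; apply: f0; rewrite -splitE.
- rewrite disj_set2E; apply/eqP/seteqP; split => // s [] /=.
  by rewrite !in_itv/= => /andP[_ sc] /andP[]; rewrite ltNge sc.
rewrite integral_itv_obnd_cbnd; last first.
  by apply: measurable_funS mf => // s; rewrite -splitE; right.
rewrite two_ln_over_sqrt// EFinD; apply: leeD.
- have := piece 0 c 1 a d (lexx 0) c0 cL (mul1r d).
  rewrite mulr0 addr0 mul1r dc (addrC a) subrK; apply => s si.
  have sL : s \in `[0, L].
    by move: si; rewrite !in_itv/= => /andP[-> /le_trans ->].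
  have := ulip _ _ sL in0; rewrite subr0 (@ger0_norm _ s); last by rewrite (itvP si).
  by rewrite ler_norml -/a => /andP[_]; lra.
- have := piece c L (-1) (b + d * L) (- d) c0 cL (lexx L).
  rewrite mulrNN mul1r !mulNr addrK mul1r opprB dc => /(_ erefl).
  have -> : b + d * L - (M / 2 - a) = M / 2 by rewrite /M; field.
  apply => s si.
  have sL : s \in `[0, L].
    by move: si; rewrite !in_itv/= => /andP[/(le_trans c0) -> ->].
  have := ulip _ _ sL inL; rewrite (distrC s) (@ger0_norm _ (L - s)).
    by rewrite ler_norml -/b => /andP[_]; rewrite mulNr; lra.
  by rewrite subr_ge0 (itvP si).
Qed.

End ReciprocalIntegral.

(** * The two inequalities *)

(** For a <= b, exponentiating and clearing denominators turns this into
    4 b (a + t) <= (a + b + t)^2, where the difference of the sides is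
    (a + t - b)^2. *)
Lemma ln_gap_le_two_ln_mean (R : realType) (a b t : R) : 0 < a -> 0 < b -> 0 <= t ->
  ln (1 + t / Num.min a b) <= 2 * ln ((a + b + t) / (2 * Num.sqrt (a * b))).
Proof.
move=> a0 b0 t0.
wlog ab : a b a0 b0 / a <= b.
  move=> wl; have [ab|/ltW ba] := leP a b.
    by have := wl a b; rewrite (min_idPl ab); exact.
  by have := wl b a; rewrite (min_idPl ba) (addrC b) (mulrC b); exact.
have M0 : 0 < a + b + t by lra.
have M20 : 0 < (a + b + t) / 2 by exact: divr_gt0.
rewrite (min_idPl ab) two_ln_over_sqrt// -!ln_div ?posrE//.
have pa : 0 < (a + b + t) / 2 / a by exact: divr_gt0.
have pb : 0 < (a + b + t) / 2 / b by exact: divr_gt0.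
rewrite -lnM ?posrE// ler_ln ?posrE; [|by rewrite ltr_pwDl// divr_ge0// ltW
  |exact: mulr_gt0].
have -> : 1 + t / a = (a + t) * b / (a * b) by field; rewrite !gt_eqF.
rewrite mulf_div ler_pM2r ?invr_gt0 ?mulr_gt0//.
have := sqr_ge0 (a + t - b); nra.
Qed.

Theorem theorem3p5 (R : realType) (n : nat) (D : set 'rV[R]_n)
    (hn : (2 <= n)%N) (hD : is_domain D) (hB : bounded_set D) :
  forall x y : 'rV[R]_n, D x -> D y ->
    zetaD D x y <= istarD D x y /\ ((istarD D x y)%:E <= mD D x y)%E.
Proof.
move=> x y Dx Dy; have [_ oD _] := hD; have n0 := ltnW hn.
have etax := etaD_gt0 n0 oD hB Dx; have etay := etaD_gt0 n0 oD hB Dy.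
have d0 := ediam_gt0 n0 oD hB Dx.
split.
  by apply: ln_gap_le_two_ln_mean => //; rewrite mulr_ge0 ?enorm_ge0 ?ltW.
apply: le_ereal_inf_tmp => _ [a [b [g [[ab cg gD [gax gby] rg] ->]]]].
pose L := fine (path_length a b g).
have L0 : 0 <= L by rewrite -lee_fin -(path_length_EFin rg)// path_length_ge0.
pose u s := etaD D (arc_param a b g s).
have arcD s : s \in `[0, L] -> D (arc_param a b g s).
  by move=> /(arc_paramP ab cg rg)[t [at_ tb _ ->]]; apply: gD; rewrite in_itv/= at_.
have xyL : enorm (x - y) <= L.
  rewrite enormB -gax -gby.
  have := chord_le_length_increment rg (lexx a) ab (lexx b).
  by rewrite path_lengthxx subr0.
have u0 : u 0 = etaD D x by rewrite /u (arc_param_start ab cg rg) gax.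
have uL : u L = etaD D y by rewrite /u (arc_param_end ab cg rg) gby.
have := @integral_lipschitz_inv_ge R (ediam D) L u d0 L0.
rewrite u0 uL => H; apply: le_trans (H _ _); last 2 first.
- by move=> s /arcD; exact: etaD_gt0.
- move=> s t sL tL.
  have := etaD_lip n0 oD hB (arcD _ sL) (arcD _ tL).
  have := etaD_lip n0 oD hB (arcD _ tL) (arcD _ sL).
  rewrite (enormB (arc_param a b g t)) -/(u s) -/(u t) => ts st.
  apply: (@le_trans _ _ (ediam D * enorm (arc_param a b g s - arc_param a b g t))).
    by rewrite ler_norml; apply/andP; split; lra.
  by rewrite ler_wpM2l ?(ltW d0)//; exact: arc_param_lip.
have s0 : 0 < 2 * Num.sqrt (etaD D x * etaD D y).
  by rewrite mulr_gt0// sqrtr_gt0 mulr_gt0.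
have num0 l : 0 <= l -> 0 < etaD D x + etaD D y + ediam D * l.
  by move=> l0; rewrite ltr_wpDr ?mulr_ge0 ?(ltW d0)// addr_gt0.
rewrite lee_fin /istarD ler_wpM2l// ler_ln ?posrE ?divr_gt0 ?num0 ?enorm_ge0//.
by rewrite ler_pM2r ?invr_gt0// lerD2l ler_wpM2l// ltW.
Qed.
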